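(* Let $\mathcal{U}$ be a block gluing $\mathbb{Z}^2$ additive shift space such that $$h_r(\mathcal{U})<\hat h^{(1)}(\mathcal{U}).$$ Then for any $h\in\left[h_r(\mathcal{U}),\hat h^{(1)}(\mathcal{U})\right)$ there exists an expanding system $\Omega=\{\Omega(n)\}_{n=1}^\infty$ of $\mathbb{Z}^2$ such that $h_\Omega(\mathcal{U})=h$. Furthermore, if the supremum $\hat h^{(1)}(\mathcal{U})$ is attained by some one-dimensional sublattice $\mathbb{L}'$, i.e. $h_{\mathbb{L}'}(\mathcal{U})=\hat h^{(1)}(\mathcal{U})$, then there exists an expanding system $\Omega=\{\Omega(n)\}_{n=1}^\infty$ of $\mathbb{Z}^2$ such that $$h_\Omega(\mathcal{U})=\hat h^{(1)}(\mathcal{U})=h_{\mathbb{L}'}(\mathcal{U}).$$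
   Context: Let $\mathcal{A}=\{0,1,\dots,N-1\}$ with $N\ge2$. An additive ($\mathbb{Z}^2$) shift space $\mathcal{U}\subseteq\mathcal{A}^{\mathbb{Z}^2}$ is a subset that is closed (in the product topology) and invariant under all shifts $\sigma^{\mathbf{v}}$, $\mathbf{v}\in\mathbb{Z}^2$, where $(\sigma^{\mathbf{v}}(x))_{i,j}=x_{(i,j)+\mathbf{v}}$. An expanding system $\Omega=\{\Omega(n)\}_{n=1}^\infty$ of $\mathbb{Z}^2$ is a sequence of finite nonempty subsets $\Omega(n)\subset\mathbb{Z}^2$ with $\Omega(n)\subseteq\Omega(n+1)$ for all $n$ and $\bigcup_{n\ge1}\Omega(n)=\mathbb{Z}^2$. For $\mathbb{L}\subset\mathbb{Z}^2$ let $\mathcal{U}|_{\mathbb{L}}=\{x|_{\mathbb{L}}: x\in\mathcal{U}\}$; for finite $\mathbb{L}$ let $\Gamma(\mathbb{L},\mathcal{U})=|\mathcal{U}|_{\mathbb{L}}|$, and $$h_\Omega(\mathcal{U})=\limsup_{n\to\infty}\frac{1}{|\Omega(n)|}\log\Gamma(\Omega(n),\mathcal{U}).$$ For $m,n\ge1$ and $(i,j)\in\mathbb{Z}^2$, let $\mathbb{Z}_{m\times n}((i,j))=\{(i+n_1,j+n_2):0\le n_1\le m-1,\ 0\le n_2\le n-1\}$ and $\mathbb{Z}_{m\times n}=\mathbb{Z}_{m\times n}((0,0))$. The rectangular entropy is $$h_r(\mathcal{U})=\limsup_{m,n\to\infty}\frac{1}{mn}\log\Gamma(\mathbb{Z}_{m\times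 n},\mathcal{U})$$ (the limit exists and equals $\inf_{m,n\ge1}\frac1{mn}\log\Gamma(\mathbb{Z}_{m\times n},\mathcal{U})$). With $d$ the Euclidean metric on $\mathbb{Z}^2$ (and $d(R_1,R_2)$ the minimal distance between points of two sets), $\mathcal{U}$ is block gluing if there is a number $M=M(\mathcal{U})\ge1$ such that for any two rectangular lattices $R_1=\mathbb{Z}_{m_1\times n_1}((i_1,j_1))$, $R_2=\mathbb{Z}_{m_2\times n_2}((i_2,j_2))$ with $m_l,n_l\ge 1$, $(i_l,j_l)\in\mathbb{Z}^2$ and $d(R_1,R_2)\ge M$, and any $U_1\in\mathcal{U}|_{R_1}$, $U_2\in\mathcal{U}|_{R_2}$, there exists $W\in\mathcal{U}$ with $W|_{R_1}=U_1$ and $W|_{R_2}=U_2$. A one-dimensional sublattice of $\mathbb{Z}^2$ is a set $\mathbb{L}=\{s\vec{\mathbf{v}}: s\in\mathbb{Z}\}$ with $\vec{\mathbf{v}}\in\mathbb{Z}^2$, $\vec{\mathbf{v}}\neq 0$. The $\mathbb{L}$ projectional entropy $h_{\mathbb{L}}(\mathcal{U})$ is the topological entropy of the $\mathbb{Z}$-shift $\mathcal{U}|_{\mathbb{L}}$ under the shift by $\vec{\mathbf{v}}$, i.e. $h_{\mathbb{L}}(\mathcal{U})=\lim_{n\to\infty}\frac1n\log\Gamma(\{s\vec{\mathbf{v}}:0\le s\le n-1\},\mathcal{U})$. Finally $$\hat h^{(1)}(\mathcal{U})=\sup\{h_{\mathbb{L}}(\mathcal{U}) : \mathbb{L}\text{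 is a one-dimensional sublattice of }\mathbb{Z}^2\}.$$ *)

(* Defs.v *)
From HB Require Import structures.
From mathcomp Require Import all_boot all_order all_algebra finmap.
From mathcomp Require Import all_classical all_reals all_analysis.

Set Implicit Arguments.
Unset Strict Implicit.
Unset Printing Implicit Defensive.

Import Order.TTheory GRing.Theory Num.Theory.
Local Open Scope classical_set_scope.
Local Open Scope ring_scope.

Notation Z2 := (int * int)%type.

(* The alphabet {0, ..., N-1} is 'I_N with its discrete topology. *)
Definition config (N : nat) := {ptws Z2 -> discrete_topology 'I_N}.

Definition shift (N : nat) (v : Z2) (x : config N) : config N :=
  fun p => x (p + v).

Definition shift_invariant (N : nat) (U : set (config N)) :=
  forall v : Z2, shift v @` U `<=` U.

Definition shift_space (N : nat) (U : set (config N)) :=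
  closed U /\ shift_invariant U.

Definition patterns (N : nat) (U : set (config N)) (L : set Z2) :
    set (L -> 'I_N) :=
  [set sigL L x | x in U].
Arguments patterns {N} U L _.

(* [fset_set] sends an infinite set to the empty one; this is only used for
   finite L, where [patterns U L] is finite. *)
Definition npatterns (N : nat) (L : set Z2) (U : set (config N)) : nat :=
  #|` fset_set (patterns U L)|.

(* Omega k stands for the k+1-st set of a system whose indices start at 1. *)
Definition expanding_system (Omega : nat -> {fset Z2}) :=
  [/\ forall n, Omega n != fset0,
      forall n, (Omega n `<=` Omega n.+1)%fset
    & \bigcup_n [set` Omega n] = [set: Z2]].

Definition entropy (R : realType) (N : nat) (Omega : nat -> {fset Z2})
    (U : set (config N)) : \bar R :=
  limn_esup (fun n =>
    ((#|` Omega n|%:R)^-1 * ln (npatterns [set` Omega n] U)%:R)%:E).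

Definition rect (p : Z2) (m n : nat) : set Z2 :=
  [set q : Z2 | p.1 <= q.1 < p.1 + m%:Z /\ p.2 <= q.2 < p.2 + n%:Z].

Definition rect_entropy (R : realType) (N : nat) (U : set (config N)) : \bar R :=
  limf_esup (fun mn : nat * nat =>
    (((mn.1 * mn.2)%:R)^-1 * ln (npatterns (rect 0 mn.1 mn.2) U)%:R)%:E)
    (filter_prod \oo \oo).

Definition dist2 (R : realType) (p q : Z2) : R :=
  Num.sqrt ((p.1 - q.1)%:~R ^+ 2 + (p.2 - q.2)%:~R ^+ 2).

Definition set_dist (R : realType) (A B : set Z2) : R :=
  inf [set dist2 R pq.1 pq.2 | pq in A `*` B].

Definition block_gluing (R : realType) (N : nat) (U : set (config N)) :=
  exists2 M : R, 1 <= M &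
    forall (p1 p2 : Z2) (m1 n1 m2 n2 : nat),
      (1 <= m1)%N -> (1 <= n1)%N -> (1 <= m2)%N -> (1 <= n2)%N ->
      let R1 := rect p1 m1 n1 in let R2 := rect p2 m2 n2 in
      M <= set_dist R R1 R2 ->
      forall (U1 : R1 -> 'I_N) (U2 : R2 -> 'I_N),
        patterns U R1 U1 -> patterns U R2 U2 ->
        exists2 W : config N, U W & sigL R1 W = U1 /\ sigL R2 W = U2.

Definition line (v : Z2) : set Z2 := range (fun s : int => v *~ s).

Definition sublattice1 (L : set Z2) := exists2 v : Z2, v != 0 & L = line v.

Definition line_entropy (R : realType) (N : nat) (v : Z2) (U : set (config N)) :
    \bar R :=
  limn (fun n => ((n%:R)^-1 *
    ln (npatterns [set v *+ s | s in `I_n] U)%:R)%:E).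

(* A one-dimensional sublattice has exactly two generators, v and - v. One of
   them is chosen; [proj_entropyE] shows that the choice is irrelevant. *)
Definition generator (L : set Z2) : Z2 :=
  xget 0 [set v : Z2 | v != 0 /\ L = line v].

Definition proj_entropy (R : realType) (N : nat) (L : set Z2)
    (U : set (config N)) : \bar R :=
  line_entropy R (generator L) U.

Definition sup_proj_entropy (R : realType) (N : nat) (U : set (config N)) :
    \bar R :=
  ereal_sup [set proj_entropy R L U | L in sublattice1].

Lemma generatorP (L : set Z2) :
  sublattice1 L -> generator L != 0 /\ L = line (generator L).
Proof.
case=> v v0 Lv; rewrite /generator.
by case: xgetP => [w _ //|/(_ v)]; case.
Qed.

Lemma line_inj (v w : Z2) : v != 0 -> line v = line w -> w = v \/ w = - v.
Proof.
move=> v0 vw.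
have [a _ wa] : line w v by rewrite -vw; exists 1 => //; rewrite mulr1z.
have [b _ vb] : line v w by rewrite vw; exists 1 => //; rewrite mulr1z.
have eab : v *~ (b * a - 1) = 0.
  by rewrite mulrzBr mulr1z mulrzA vb wa subrr.
have ba : b * a = 1.
  apply/eqP; rewrite -subr_eq0; apply: contraNT v0 => ab0.
  case: v eab {vw wa vb} => v1 v2 e.
  have := congr1 fst e; have := congr1 snd e.
  rewrite /= !raddfMz /= => /eqP; rewrite mulrz_eq0 (negPf ab0) /= => /eqP ->.
  by move=> /eqP; rewrite mulrz_eq0 (negPf ab0) /= => /eqP ->.
have : b \is a GRing.unit by apply/unitrPr; exists a.
rewrite -vb unfold_in /= => /orP[]/eqP ->.
  by left; rewrite mulr1z.
by right; rewrite mulrNz mulr1z.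
Qed.

Lemma card_patterns_translate (N : nat) (U : set (config N)) (L : set Z2)
    (t : Z2) : shift_invariant U ->
  (patterns U L #<= patterns U [set (p + t : Z2) | p in L])%card.
Proof.
move=> Ui; set Lt := [set _ | _ in _].
have mem_t (l : L) : val l + t \in Lt.
  by apply/mem_set; exists (val l) => //; exact: set_valP.
pose phi (g : Lt -> 'I_N) : L -> 'I_N := fun l => g (SigSub (mem_t l)).
apply: card_le_trans (card_image_le phi (patterns U Lt)).
apply: subset_card_le => _ [x Ux <-].
exists (sigL Lt (shift (- t) x)); last first.
  by apply/funext => l; rewrite /phi /sigL /= /shift /= addrK.
by exists (shift (- t) x) => //; apply: (Ui (- t)); exists x.
Qed.

Lemma npatterns_translate (N : nat) (U : set (config N)) (L : set Z2) (t : Z2) :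
  shift_invariant U ->
  npatterns [set (p + t : Z2) | p in L] U = npatterns L U.
Proof.
move=> Ui; rewrite /npatterns.
have : (patterns U [set (p + t : Z2) | p in L] #= patterns U L)%card.
  rewrite card_eq_le card_patterns_translate // andbT.
  have := card_patterns_translate [set (p + t : Z2) | p in L] (- t) Ui.
  suff -> : [set (p - t : Z2) | p in [set (p + t : Z2) | p in L]] = L by [].
  by rewrite image_comp; apply: eq_image_id => p _ /=; rewrite addrK.
have [fL|iL] := pselect (finite_set (patterns U L)) => eL.
  by apply/fcard_eq => //; rewrite (eq_finite_set eL).
have iLt := iL; rewrite -(eq_finite_set eL) in iLt.
by rewrite /fset_set; do 2 case: pselect => //.
Qed.

Lemma mulrn_translateN (V : zmodType) (v : V) (m s : nat) : (s <= m)%N ->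
  v *+ s + (- v) *+ m = (- v) *+ (m - s).
Proof.
by move=> sm; rewrite -{1}(subnK sm) mulrnDr addrCA !mulNrn subrr addr0.
Qed.

Lemma line_entropyN (R : realType) (N : nat) (v : Z2) (U : set (config N)) :
  shift_invariant U -> line_entropy R (- v) U = line_entropy R v U.
Proof.
move=> Ui; rewrite /line_entropy; congr (limn _); apply/funext => n.
congr ((_ * ln _%:R)%:E).
rewrite -(npatterns_translate [set v *+ s | s in `I_n] ((- v) *+ n.-1) Ui).
have lt_pred s : (s < n)%N -> (s <= n.-1)%N by case: n.
have sub_lt s : (s < n)%N -> (n.-1 - s < n)%N.
  by case: n {lt_pred} => // n _; rewrite ltnS leq_subr.
congr npatterns; rewrite image_comp; apply/seteqP; split=> _ [s sn <-].
- exists (n.-1 - s)%N; first exact: sub_lt.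
  rewrite [LHS]mulrn_translateN ?leq_subr //.
  by rewrite subKn // lt_pred.
- exists (n.-1 - s)%N; first exact: sub_lt.
  by rewrite -mulrn_translateN // lt_pred.
Qed.

Lemma proj_entropyE (R : realType) (N : nat) (v : Z2) (U : set (config N)) :
  shift_invariant U -> v != 0 -> proj_entropy R (line v) U = line_entropy R v U.
Proof.
move=> Ui v0; rewrite /proj_entropy.
have sv : sublattice1 (line v) by exists v.
have [_ /(line_inj v0)[->|->]] := generatorP sv => //.
exact: line_entropyN.
Qed.

(* Main.v *)
(* The patterns of U on the square [-n, n]^2 together with the first l_n points
   of a ray {s v : s >= 0}. By block gluing the square and the part of the ray
   with s >= n + K are independent, and the other n + K points of the ray
   matter only to order n, so the logarithm of the number of patterns is
   h_r A_n + h_L l_n + o(A_n + l_n), where A_n = (2n + 1)^2. Hence the entropy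
   is h = (h_r + c h_L) / (1 + c) for l_n = floor(c A_n), which takes every
   value in [h_r, h_L), and it is h_L for l_n = n A_n. *)

Require Import Defs.
From mathcomp Require Import all_boot all_order all_algebra finmap.
From mathcomp Require Import all_classical all_reals all_analysis.
From mathcomp Require Import zify ring lra.

Import Order.TTheory GRing.Theory Num.Theory.
Import numFieldNormedType.Exports.

Local Open Scope classical_set_scope.
Local Open Scope ring_scope.

Set Implicit Arguments.
Unset Strict Implicit.
Unset Printing Implicit Defensive.

(** * Counting patterns *)

(** Each comparison of pattern counts below comes from a map whose image covers the patterns on the
    smaller side. *)
Lemma card_fset_set_image_le (T T' : choiceType) (A : set T) (B : set T')
    (f : T' -> T) :
  finite_set B -> A `<=` f @` B -> (#|` fset_set A| <= #|` fset_set B|)%N.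
Proof.
move=> finB AB; have finfB : finite_set (f @` B) by exact: finite_image.
have finA := sub_finite_set AB finfB.
rewrite (fset_set_sub finA finfB) in AB.
by rewrite (leq_trans (fsubset_leq_card AB)) // fset_set_image // leq_imfset_card.
Qed.

Lemma card_fsetX (T T' : choiceType) (A : {fset T}) (B : {fset T'}) :
  #|` (A `*` B)%fset| = (#|` A| * #|` B|)%N.
Proof.
rewrite -(size_allpairs pair); apply/perm_size/uniq_perm.
- exact: fset_uniq.
- by apply: allpairs_uniq => [||[? ?] [? ?]]; rewrite ?fset_uniq.
- move=> [a b]; rewrite in_fsetM; apply/idP/allpairsP.
    by move=> /andP[Aa Bb]; exists (a, b).
  by move=> [[a' b'] [/= ? ? [-> ->]]]; apply/andP.
Qed.

Lemma valL_sigL (T V : Type) (d : V) (A : set T) (x : T -> V) (p : T) :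
  A p -> 'valL_d (sigL A x) p = x p.
Proof.
by move=> Ap; have /= -> := congr1 (fun f => f x p) (@sigLK _ _ d A);
  rewrite /patch mem_set.
Qed.

Lemma sigL_valL_sub (T V : Type) (d : V) (A B : set T) (x : T -> V) :
  A `<=` B -> sigL A ('valL_d (sigL B x)) = sigL A x.
Proof. by move=> AB; apply/eq_sigLP => p /set_mem/AB; exact: valL_sigL. Qed.

Lemma finite_card_patterns (N : nat) (U : set (config N)) (A : {fset Z2}) :
  finite_set (patterns U [set` A]) /\ (npatterns [set` A] U <= N ^ #|` A|)%N.
Proof.
(* ['I_N] may be empty, so a configuration [x0] of [U] supplies the values outside [A], which
   restriction discards. *)
have [->|/set0P[x0 _]] := eqVneq U set0.
  by rewrite /npatterns /patterns image_set0 fset_set0 cardfs0.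
pose phi (g : {ffun A -> 'I_N}) : [set` A] -> 'I_N :=
  sigL [set` A] (fun p => if insub p is Some a then g a else x0 p).
have sub : patterns U [set` A] `<=` phi @` setT.
  move=> _ [x _ <-]; exists [ffun a => x (val a)] => //.
  apply/eq_sigLP => p; rewrite inE => /= pA.
  by rewrite insubT ffunE.
have fT : finite_set [set: {ffun A -> 'I_N}] by exact: finite_finset.
split; first exact: sub_finite_set sub (finite_image _ fT).
rewrite (leq_trans (card_fset_set_image_le fT sub)) //.
have -> : (N ^ #|` A|)%N = #|{: {ffun A -> 'I_N}}|.
  by rewrite card_ffun card_ord cardfE.
by rewrite -(card_uniqP (fset_uniq _)) max_card.
Qed.

Lemma finite_patterns (N : nat) (U : set (config N)) (L : set Z2) :
  finite_set L -> finite_set (patterns U L).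
Proof.
by move=> /fset_setK <-; have [] := finite_card_patterns U (fset_set L).
Qed.

Lemma npatterns_gt0 (N : nat) (U : set (config N)) (L : set Z2) :
  U !=set0 -> finite_set L -> (0 < npatterns L U)%N.
Proof.
move=> [x Ux] finL; rewrite cardfs_gt0; apply/fset0Pn; exists (sigL L x).
by rewrite in_fset_set ?inE; [exists x|exact: finite_patterns].
Qed.

Lemma le_npatterns (N : nat) (U : set (config N)) (A B : set Z2) :
  finite_set B -> A `<=` B -> (npatterns A U <= npatterns B U)%N.
Proof.
move=> finB AB; have [->|/set0P[x0 _]] := eqVneq U set0.
  by rewrite /npatterns /patterns image_set0 fset_set0 cardfs0.
apply: (card_fset_set_image_le (f := fun g => sigL A ('valL_(x0 0) g))).
  exact: finite_patterns.
move=> _ [x Ux <-]; exists (sigL B x); last exact: sigL_valL_sub.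
by exists x.
Qed.

(** A pattern on the union is recovered from its two restrictions. On the overlap [glue] follows
    [A], which is harmless because both restrictions come from one configuration. *)
Lemma npatternsU_le (N : nat) (U : set (config N)) (A B : set Z2) :
  finite_set A -> finite_set B ->
  (npatterns (A `|` B) U <= npatterns A U * npatterns B U)%N.
Proof.
move=> finA finB; have [->|/set0P[x0 _]] := eqVneq U set0.
  by rewrite /npatterns /patterns image_set0 fset_set0 cardfs0.
have [fA fB] := (finite_patterns U finA, finite_patterns U finB).
have -> : (npatterns A U * npatterns B U)%N =
    #|` fset_set (patterns U A `*` patterns U B)|.
  by rewrite fset_setX // card_fsetX.
pose glue (gh : (A -> 'I_N) * (B -> 'I_N)) := sigL (A `|` B)
  (fun p => if p \in A then 'valL_(x0 0) gh.1 p else 'valL_(x0 0) gh.2 p).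
apply: (card_fset_set_image_le (f := glue)); first exact: finite_setX.
move=> _ [x Ux <-]; exists (sigL A x, sigL B x); first by split; exists x.
apply/eq_sigLP => p; rewrite inE => ABp; case: ifPn => Ap.
  by rewrite valL_sigL //; exact: set_mem.
by rewrite valL_sigL //; case: ABp => // /mem_set; rewrite (negPf Ap).
Qed.

(** The hypothesis makes the two restrictions independent: splitting a pattern of the union reaches
    every pair. *)
Lemma npatternsU_ge (N : nat) (U : set (config N)) (A B : set Z2) :
  finite_set A -> finite_set B ->
  (forall x y, U x -> U y -> exists2 W, U W &
     sigL A W = sigL A x /\ sigL B W = sigL B y) ->
  (npatterns A U * npatterns B U <= npatterns (A `|` B) U)%N.
Proof.
move=> finA finB glued; have [->|/set0P[x0 _]] := eqVneq U set0.
  by rewrite /npatterns /patterns image_set0 fset_set0 cardfs0.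
have [fA fB] := (finite_patterns U finA, finite_patterns U finB).
have -> : (npatterns A U * npatterns B U)%N =
    #|` fset_set (patterns U A `*` patterns U B)|.
  by rewrite fset_setX // card_fsetX.
pose split_pattern (g : (A `|` B) -> 'I_N) :=
  (sigL A ('valL_(x0 0) g), sigL B ('valL_(x0 0) g)).
apply: (card_fset_set_image_le (f := split_pattern)).
  by apply: finite_patterns; rewrite finite_setU.
move=> [f g] [/= [x Ux <-] [y Uy <-]]; have [W UW [<- <-]] := glued x y Ux Uy.
exists (sigL (A `|` B) W); first by exists W.
by rewrite /split_pattern !sigL_valL_sub.
Qed.

Definition lnpatterns (R : realType) (N : nat) (U : set (config N))
    (L : set Z2) : R :=
  ln (npatterns L U)%:R.
Arguments lnpatterns R {N} U L.

Lemma lnpatterns_ge0 (R : realType) (N : nat) (U : set (config N))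
    (L : set Z2) : 0 <= lnpatterns R U L.
Proof.
rewrite /lnpatterns; case: npatterns => [|n]; first by rewrite ln0.
by rewrite ln_ge0 // ler1n.
Qed.

Lemma le_lnpatterns (R : realType) (N : nat) (U : set (config N))
    (A B : set Z2) : U !=set0 -> finite_set B -> A `<=` B ->
  lnpatterns R U A <= lnpatterns R U B.
Proof.
move=> U0 finB AB; have finA := sub_finite_set AB finB.
by rewrite ler_ln ?posrE ?ltr0n ?npatterns_gt0 // ler_nat le_npatterns.
Qed.

Lemma lnpatternsU_le (R : realType) (N : nat) (U : set (config N))
    (A B : set Z2) : U !=set0 -> finite_set A -> finite_set B ->
  lnpatterns R U (A `|` B) <= lnpatterns R U A + lnpatterns R U B.
Proof.
move=> U0 finA finB.
rewrite /lnpatterns -lnM ?posrE ?ltr0n ?npatterns_gt0 // -natrM.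
rewrite ler_ln ?posrE ?ltr0n ?muln_gt0 ?npatterns_gt0 ?finite_setU //.
by rewrite ler_nat npatternsU_le.
Qed.

Lemma lnpatternsU_ge (R : realType) (N : nat) (U : set (config N))
    (A B : set Z2) : U !=set0 -> finite_set A -> finite_set B ->
  (forall x y, U x -> U y -> exists2 W, U W &
     sigL A W = sigL A x /\ sigL B W = sigL B y) ->
  lnpatterns R U A + lnpatterns R U B <= lnpatterns R U (A `|` B).
Proof.
move=> U0 finA finB glued.
rewrite /lnpatterns -lnM ?posrE ?ltr0n ?npatterns_gt0 // -natrM.
rewrite ler_ln ?posrE ?ltr0n ?muln_gt0 ?npatterns_gt0 ?finite_setU //.
by rewrite ler_nat npatternsU_ge.
Qed.

Lemma lnpatterns_le_card (R : realType) (N : nat) (U : set (config N))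
    (A : {fset Z2}) : U !=set0 ->
  lnpatterns R U [set` A] <= #|` A|%:R * ln N%:R.
Proof.
move=> U0; have [x _] := U0.
have N0 : (0 < N)%N by apply: leq_ltn_trans (ltn_ord (x 0)).
rewrite mulr_natl -lnXn ?ltr0n // -natrX.
rewrite ler_ln ?posrE ?ltr0n ?expn_gt0 ?N0 ?npatterns_gt0 //.
by rewrite ler_nat; have [] := finite_card_patterns U A.
Qed.

(** * Subadditivity *)

(** Monotonicity allows [n] to be rounded up to a multiple of [k], at the cost of one extra block
    and with no remainder term. *)
Lemma subadditive_le (R : realType) (u : nat -> R) (k n : nat) :
  (0 < k)%N -> 0 <= u k -> {homo u : i j / (i <= j)%N >-> i <= j} ->
  (forall i j, u (i + j)%N <= u i + u j) ->
  u n <= (n%:R / k%:R + 1) * u k.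
Proof.
move=> k0 uk0 umono usub.
have umul q : u (q.+1 * k)%N <= q.+1%:R * u k.
  elim: q => [|q IH]; first by rewrite !mul1n mul1r.
  by rewrite mulSn -[q.+2%:R]natr1; have := usub k (q.+1 * k)%N; lra.
apply: le_trans (umono _ _ _) (le_trans (umul (n %/ k)%N) _).
  exact: ltnW (ltn_ceil _ _).
rewrite ler_wpM2r // -natr1 lerD2r ler_pdivlMr ?ltr0n //.
by rewrite -natrM ler_nat leq_trunc_div.
Qed.

(** Here [h] is the infimum of [u k / k] over positive [k], and [C] is [u k] for a nearly optimal
    [k]. The bounds hold for all [n], not just in the limit, because the segment lengths they are
    applied to may stay bounded. *)
Lemma fekete (R : realType) (u : nat -> R) :
  (forall n, 0 <= u n) -> {homo u : i j / (i <= j)%N >-> i <= j} ->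
  (forall i j, u (i + j)%N <= u i + u j) ->
  exists h : R, (forall n, h * n%:R <= u n) /\
    forall e, 0 < e -> exists C, forall n, u n <= (h + e) * n%:R + C.
Proof.
move=> u0 umono usub; pose S := [set u k.+1 / k.+1%:R | k in [set: nat]].
have S0 : S !=set0 by exists (u 1%N / 1); exists 0%N.
have Slb : lbound S 0 by move=> _ [k _ <-]; rewrite divr_ge0.
have Sinf : has_inf S by split => //; exists 0.
exists (inf S); split=> [[|n]|e e0].
- by rewrite mulr0.
- rewrite -ler_pdivlMr ?ltr0n //; apply: ge_inf; first by exists 0.
  by exists n.
have [_ [k _ <-] ke] := inf_adherent e0 Sinf.
exists (u k.+1) => n; apply: le_trans (subadditive_le n (ltn0Sn k) _ umono usub) _ => //.
have : n%:R * (u k.+1 / k.+1%:R) <= n%:R * (inf S + e).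
  by rewrite ler_wpM2l // ltW.
by move: k.+1%:R^-1 => r; lra.
Qed.

(** Tiling by a nearly optimal block in both directions leaves an error of the order of the
    perimeter, negligible against the area when both sides are long. *)
Lemma fekete2 (R : realType) (G : nat -> nat -> R) :
  (forall m n, 0 <= G m n) ->
  (forall n, {homo G ^~ n : i j / (i <= j)%N >-> i <= j}) ->
  (forall m, {homo G m : i j / (i <= j)%N >-> i <= j}) ->
  (forall i j n, G (i + j)%N n <= G i n + G j n) ->
  (forall m i j, G m (i + j)%N <= G m i + G m j) ->
  exists h : R, (forall m n, h * (m * n)%:R <= G m n) /\
    forall e, 0 < e -> exists T, forall m n, (T <= m)%N -> (T <= n)%N ->
      G m n <= (h + e) * (m * n)%:R.
Proof.
move=> G0 mono1 mono2 sub1 sub2.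
pose S := [set G k.1.+1 k.2.+1 / (k.1.+1 * k.2.+1)%:R | k in [set: nat * nat]].
have S0 : S !=set0 by exists (G 1%N 1%N / 1); exists (0%N, 0%N).
have Slb : lbound S 0 by move=> _ [k _ <-]; rewrite divr_ge0.
have Sinf : has_inf S by split => //; exists 0.
exists (inf S); split=> [[|m] [|n]|e e0]; rewrite ?muln0 ?mul0n ?mulr0 //.
  rewrite -ler_pdivlMr ?ltr0n //; apply: ge_inf; first by exists 0.
  by exists (m, n).
(* Half of [e] pays for the choice of the block, the other half for the perimeter. *)
have [_ [[k l] _ <-] /= kle] := inf_adherent (divr_gt0 e0 (ltr0Sn _ 1)) Sinf.
set g := G k.+1 l.+1 in kle *.
have g0 : 0 <= g by exact: G0.
(* Since [T (m + n + 1) <= 3 m n], this [T] brings [(m + n + 1) g] below [(e / 2) m n]. *)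
have [T Tg] : exists T : nat, 6%:R * g / e < T%:R.
  exists (Num.bound (6%:R * g / e)); apply: archi_boundP.
  by rewrite divr_ge0 ?mulr_ge0 // ltW.
exists T.+1 => m n Tm Tn.
have [kR lR] : 0 < k.+1%:R :> R /\ 0 < l.+1%:R :> R by rewrite !ltr0n.
have le1 : G m n <= (m%:R / k.+1%:R + 1) * ((n%:R / l.+1%:R + 1) * g).
  apply: le_trans (subadditive_le m (ltn0Sn k) (G0 _ _) (mono1 n) _) _ => //.
  rewrite ler_wpM2l ?addr_ge0 ?divr_ge0 //.
  exact: (subadditive_le n (ltn0Sn l) _ (mono2 _)).
apply: le_trans le1 _.
have mnT : 3%:R * (m * n)%:R >= T%:R * (m%:R + n%:R + 1) :> R.
  by rewrite -!natrD natr1 -!natrM ler_nat; nia.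
have k1 : k.+1%:R^-1 <= 1 :> R by rewrite invf_le1 // ler1n.
have l1 : l.+1%:R^-1 <= 1 :> R by rewrite invf_le1 // ler1n.
have -> : (m%:R / k.+1%:R + 1) * ((n%:R / l.+1%:R + 1) * g) =
    (m * n)%:R * (g / (k.+1 * l.+1)%:R) +
    (m%:R / k.+1%:R + n%:R / l.+1%:R + 1) * g.
  by rewrite !natrM invfM; move: k.+1%:R^-1 l.+1%:R^-1 => a b; ring.
have le2 : (m%:R / k.+1%:R + n%:R / l.+1%:R + 1) * g <= (m%:R + n%:R + 1) * g.
  by rewrite ler_wpM2r // lerD2r lerD // ler_piMr.
have le3 : (m * n)%:R * (g / (k.+1 * l.+1)%:R) <=
    (m * n)%:R * (inf S + e / 2%:R).
  by rewrite ler_wpM2l // ltW.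
have le4 : (m%:R + n%:R + 1) * g <= e / 2%:R * (m * n)%:R.
  move: Tg; rewrite ltr_pdivrMr // => Tg.
  have s0 : 0 <= (m%:R + n%:R + 1) :> R by rewrite !addr_ge0.
  have := ler_wpM2r s0 (ltW Tg); have := ler_wpM2r (ltW e0) mnT; lra.
by apply: le_trans (lerD le3 (le_trans le2 le4)) _; lra.
Qed.

(** * Rectangles and segments *)

Lemma pair_mulrn (v : Z2) (s : nat) : v *+ s = (v.1 * s%:Z, v.2 * s%:Z).
Proof.
elim: s => [|s IH]; first by rewrite mulr0n !mulr0.
by rewrite mulrS IH; congr pair => /=; lia.
Qed.

Definition rectfs (p : Z2) (m n : nat) : {fset Z2} :=
  [fset q in [seq (p.1 + i%:Z, p.2 + j%:Z)%R
    | i <- iota 0 m, j <- iota 0 n]]%fset.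

Definition segfs (v : Z2) (n : nat) : {fset Z2} :=
  [fset q in [seq (v *+ s)%R | s <- iota 0 n]]%fset.

Lemma rectfsE (p : Z2) (m n : nat) : [set` rectfs p m n] = rect p m n.
Proof.
apply/seteqP; split=> [q|[q1 q2]] /=; rewrite !inE.
  move=> /allpairsP[[i j]] /=; rewrite !mem_iota => -[im jn ->] /=.
  by rewrite /rect /=; lia.
case=> /= h1 h2; apply/allpairsP; exists (`|q1 - p.1|%N, `|q2 - p.2|%N) => /=.
by rewrite !mem_iota; split; [lia|lia|congr pair; lia].
Qed.

Lemma card_rectfs (p : Z2) (m n : nat) : #|` rectfs p m n| = (m * n)%N.
Proof.
rewrite card_fseq undup_id ?size_allpairs ?size_iota //.
apply: allpairs_uniq; rewrite ?iota_uniq // => -[i j] [i' j'] _ _ /= [? ?].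
by congr pair; lia.
Qed.

Lemma finite_rect (p : Z2) (m n : nat) : finite_set (rect p m n).
Proof. by rewrite -rectfsE; exact: finite_fset. Qed.

Lemma segfsE (v : Z2) (n : nat) : [set` segfs v n] = [set v *+ s | s in `I_n].
Proof.
apply/seteqP; split=> [q|_ [s /= sn <-]] /=; rewrite !inE.
  by move=> /mapP[s]; rewrite mem_iota => sn ->; exists s.
by apply/mapP; exists s; rewrite ?mem_iota.
Qed.

Lemma card_segfs (v : Z2) (n : nat) : v != 0 -> #|` segfs v n| = n.
Proof.
move=> v0; rewrite card_fseq undup_id ?size_map ?size_iota //.
rewrite map_inj_uniq ?iota_uniq // => i j; rewrite !pair_mulrn => -[e1 e2].
move: v0; apply: contra_neq_eq => ij; case: v e1 e2 => a b /= e1 e2.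
by congr pair; nia.
Qed.

Lemma finite_segment (v : Z2) (n : nat) :
  finite_set [set v *+ s | s in `I_n].
Proof. by rewrite -segfsE; exact: finite_fset. Qed.

(** * Line and rectangular entropies as limits *)

(** The set where [f] is [e]-close to [l] bounds the limsup from above, and it meets every member of
    [F], which bounds it from below. The general filter covers both sequences and the product filter
    of [rect_entropy]. *)
Lemma limf_esup_near (T : choiceType) (X : filteredType T) (R : realType)
    (F : set_system X) (FF : ProperFilter F) (f : X -> R) (l : R) :
  (forall e, 0 < e -> \forall x \near F, `|f x - l| <= e) ->
  limf_esup (fun x => (f x)%:E) F = l%:E.
Proof.
move=> fl; apply/eqP; rewrite eq_le; apply/andP; split.
  apply/lee_addgt0Pr => e e0.
  apply: le_trans (ereal_inf_lbound _) _.
    by exists [set x | `|f x - l| <= e] => //; exact: fl.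
  apply: ge_ereal_sup => _ [x /= fxl <-].
  by rewrite -EFinD lee_fin; move: fxl; rewrite ler_norml; lra.
apply: le_ereal_inf_tmp => _ [V FV <-].
apply/lee_addgt0Pr => e e0.
have [x [Vx /= fxl]] := filter_ex (filterI FV (fl e e0)).
rewrite -leeBlDr // ; apply: le_trans (ereal_sup_ubound _); last by exists x.
by rewrite -EFinB lee_fin; move: fxl; rewrite ler_norml; lra.
Qed.

(** A segment of length [i + j] is one of length [i] followed by a translate of one of length [j],
    and shift invariance makes counts translation invariant. *)
Lemma line_entropy_fekete (R : realType) (N : nat) (U : set (config N))
    (v : Z2) : U !=set0 -> shift_invariant U ->
  exists h : R, [/\ line_entropy R v U = h%:E,
    forall n, h * n%:R <= lnpatterns R U [set` segfs v n] &
    forall e, 0 < e -> exists C, forall n,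
      lnpatterns R U [set` segfs v n] <= (h + e) * n%:R + C].
Proof.
move=> U0 Ui; pose u n := lnpatterns R U [set` segfs v n].
have umono : {homo u : i j / (i <= j)%N >-> i <= j}.
  move=> i j ij; apply: le_lnpatterns => //.
  rewrite !segfsE => _ [s /= si <-]; exists s => //=; exact: leq_trans ij.
have usub i j : u (i + j)%N <= u i + u j.
  rewrite /u [in X in _ + X]/lnpatterns (segfsE v j).
  rewrite -(npatterns_translate [set v *+ s | s in `I_j] (v *+ i) Ui).
  have fin := finite_image (+%R^~ (v *+ i)) (finite_segment v j).
  apply: le_trans (lnpatternsU_le R U0 (finite_fset _) fin).
  apply: le_lnpatterns => //; first by rewrite finite_setU; split.
  rewrite !segfsE => _ [s /= sij <-].
  have [si|si] := ltnP s i; [by left; exists s|right].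
  exists (v *+ (s - i)); last by rewrite -mulrnDr subnK.
  by exists (s - i)%N => //=; rewrite ltn_subLR.
have [h [hle hge]] := fekete (fun n => lnpatterns_ge0 R U _) umono usub.
exists h; split=> //; rewrite /line_entropy; apply: cvg_lim => //.
apply/fine_cvgP; split; first exact: nearW.
(* The other half of [e] absorbs the constant [C] once [n >= 2 C / e]. *)
apply/cvgrPdist_le => e e0; have [C hC] := hge _ (divr_gt0 e0 (ltr0Sn _ 1)).
near=> n.
have n0 : 0 < n%:R :> R by rewrite ltr0n; near: n; exists 1%N.
have Cn : C * 2%:R / e <= n%:R by near: n; exact: nbhs_infty_ger.
rewrite /= -[ln _]/(lnpatterns R U _) -segfsE -/(u n).
have -> : h - n%:R^-1 * u n = (h * n%:R - u n) / n%:R.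
  by rewrite mulrBl mulfK ?gt_eqF // [in RHS]mulrC.
rewrite ler_norml ler_pdivlMr // ler_pdivrMr //.
move: Cn (hle n) (hC n); rewrite ler_pdivrMr // -/(u n); nra.
Unshelve. all: by end_near. Qed.

(** Cutting a rectangle across either side gives subadditivity in each variable. The base point is
    arbitrary so that the bounds apply to squares centred at the origin. *)
Lemma rect_entropy_fekete (R : realType) (N : nat) (U : set (config N)) :
  U !=set0 -> shift_invariant U ->
  exists h : R, [/\ rect_entropy R U = h%:E,
    forall p m n, h * (m * n)%:R <= lnpatterns R U (rect p m n) &
    forall e, 0 < e -> exists T, forall p m n, (T <= m)%N -> (T <= n)%N ->
      lnpatterns R U (rect p m n) <= (h + e) * (m * n)%:R].
Proof.
move=> U0 Ui; pose G m n := lnpatterns R U (rect 0 m n).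
have mono m m' n n' : (m <= m')%N -> (n <= n')%N -> G m n <= G m' n'.
  move=> mm nn; apply: le_lnpatterns => //; first exact: finite_rect.
  by move=> [a b]; rewrite /rect /=; lia.
have trans p m n : npatterns (rect p m n) U = npatterns (rect 0 m n) U.
  rewrite -(npatterns_translate (rect 0 m n) p Ui); congr npatterns.
  apply/seteqP; split=> [[a b] /= h|_ [[a b] /= h <-]].
    exists ((a, b) - p); last by rewrite subrK.
    by move: h; rewrite /rect /=; lia.
  by move: h; rewrite /rect /=; lia.
have sub m n m' n' p A B : rect 0 A B `<=` rect 0 m n `|` rect p m' n' ->
    G A B <= G m n + G m' n'.
  have -> : G m' n' = lnpatterns R U (rect p m' n').
    by rewrite /G /lnpatterns (trans p).
  move=> AB.
  apply: le_trans (lnpatternsU_le R U0 (finite_rect _ _ _) (finite_rect _ _ _)).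
  by apply: le_lnpatterns => //; rewrite finite_setU; split; exact: finite_rect.
have sub1 i j n : G (i + j)%N n <= G i n + G j n.
  apply: (sub _ _ _ _ (i%:Z, 0)) => -[a b]; rewrite /rect /=.
  by case: (ltP a i%:Z) => ai; [left|right]; lia.
have sub2 m i j : G m (i + j)%N <= G m i + G m j.
  apply: (sub _ _ _ _ (0, i%:Z)) => -[a b]; rewrite /rect /=.
  by case: (ltP b i%:Z) => bi; [left|right]; lia.
have [h [hle hge]] := fekete2 (fun m n => lnpatterns_ge0 R U _)
  (fun n i j ij => mono _ _ _ _ ij (leqnn n))
  (fun m i j ij => mono _ _ _ _ (leqnn m) ij) sub1 sub2.
exists h; split; first last.
- by move=> e /hge[T hT]; exists T => p m n; rewrite /lnpatterns trans; exact: hT.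
- by move=> p m n; rewrite /lnpatterns trans; exact: hle.
apply: limf_esup_near => e e0; have [T hT] := hge e e0.
(* The successor keeps both sides positive, so that the area can be divided by. *)
exists ([set n | (T.+1 <= n)%N], [set n | (T.+1 <= n)%N]).
  by split; exists T.+1.
move=> [m n] /= [Tm Tn]; rewrite -[ln _]/(G m n).
have mn0 : 0 < (m * n)%:R :> R by rewrite ltr0n muln_gt0; lia.
have -> : (m * n)%:R^-1 * G m n - h = (G m n - h * (m * n)%:R) / (m * n)%:R.
  by rewrite mulrBl mulfK ?gt_eqF // [in RHS]mulrC.
rewrite ler_norml ler_pdivlMr // ler_pdivrMr //.
move: (hle m n) (hT m n (ltnW Tm) (ltnW Tn)); rewrite -/(G m n); nra.
Qed.

Lemma mem_rectfs (p : Z2) (m n : nat) (q : Z2) :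
  q \in rectfs p m n <-> rect p m n q.
Proof. by rewrite -rectfsE. Qed.

Lemma mem_segfs (v : Z2) (n : nat) (q : Z2) :
  q \in segfs v n <-> exists2 s, (s < n)%N & v *+ s = q.
Proof.
by rewrite -[X in _ <-> X]/([set v *+ s | s in `I_n] q) -segfsE.
Qed.

Definition square (n : nat) : {fset Z2} :=
  rectfs (- n%:Z, - n%:Z) n.*2.+1 n.*2.+1.

Lemma mem_square (n : nat) (q : Z2) :
  (q \in square n) = (- n%:Z <= q.1 <= n%:Z) && (- n%:Z <= q.2 <= n%:Z).
Proof.
apply/idP/idP => [/mem_rectfs|h]; last apply/mem_rectfs.
  by rewrite /rect /=; lia.
by move: h; rewrite /rect /=; lia.
Qed.

(** * Block gluing *)

Lemma fset_bounded (B : {fset Z2}) :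
  exists k : nat, forall q, q \in B ->
    (- k%:Z <= q.1 <= k%:Z) && (- k%:Z <= q.2 <= k%:Z).
Proof.
exists (\max_(q <- B) (`|q.1| + `|q.2|))%N => q qB.
have := @leq_bigmax_seq _ _ predT (fun q => `|q.1| + `|q.2|)%N _ qB isT => /=; lia.
Qed.

Lemma le_set_dist (R : realType) (A B : set Z2) (M : R) :
  A !=set0 -> B !=set0 -> (forall p q, A p -> B q -> M <= dist2 R p q) ->
  M <= set_dist R A B.
Proof.
move=> [p Ap] [q Bq] MAB; apply: lb_le_inf; first by exists (dist2 R p q), (p, q).
by move=> _ [[p' q'] [/= ? ?] <-]; exact: MAB.
Qed.

(** One coordinate difference alone bounds the Euclidean distance from below. *)
Lemma le_dist2 (R : realType) (p q : Z2) (K : nat) :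
  (p.1 + K%:Z <= q.1) || (p.2 + K%:Z <= q.2) -> K%:R <= dist2 R p q.
Proof.
have KR (a b : int) : a + K%:Z <= b -> K%:R ^+ 2 <= (a - b)%:~R ^+ 2 :> R.
  move=> ab; rewrite -[leRHS]real_normK ?num_real // ler_sqr ?nnegrE //.
  by rewrite -intr_norm -[K%:R]/(K%:Z%:~R) ler_int; lia.
rewrite -[K%:R]ger0_norm // -sqrtr_sqr => /orP[] /KR h; apply: ler_wsqrtr.
  by rewrite (le_trans h) // lerDl sqr_ge0.
by rewrite (le_trans h) // lerDr sqr_ge0.
Qed.

(** Block gluing speaks of rectangles only, so [B] is enclosed in a rectangle inside the same
    half-plane, at distance at least [K] from the square; the glued configuration is then restricted
    to [B]. One [K] serves all [n] and [B]. *)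
Lemma block_gluing_square (R : realType) (N : nat) (U : set (config N)) :
  block_gluing R U -> exists K : nat, forall (n : nat) (B : {fset Z2}),
    (forall q, q \in B -> (n + K)%:Z <= q.1) \/
    (forall q, q \in B -> (n + K)%:Z <= q.2) ->
    forall x y, U x -> U y -> exists2 W, U W &
      sigL [set` square n] W = sigL [set` square n] x /\
      sigL [set` B] W = sigL [set` B] y.
Proof.
move=> [M M1 glue]; exists (Num.bound M) => n B BK x y Ux Uy.
have MK : M <= (Num.bound M)%:R by rewrite ltW // archi_boundP // (le_trans ler01).
set K := Num.bound M in BK MK.
have [k Bk] := fset_bounded B.
suff [p [m [m' [m0 m'0 BR2 far]]]] : exists p m m', [/\ (1 <= m)%N, (1 <= m')%N,
    [set` B] `<=` rect p m m' & forall a b, [set` square n] a ->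
    rect p m m' b -> (a.1 + K%:Z <= b.1) || (a.2 + K%:Z <= b.2)].
  have MR : M <= set_dist R (rect (- n%:Z, - n%:Z) n.*2.+1 n.*2.+1) (rect p m m').
    apply: le_set_dist.
    - by exists 0; rewrite /rect /=; lia.
    - by exists p; rewrite /rect /=; lia.
    - move=> a b; rewrite -rectfsE => /far h /h /(le_dist2 R); exact: le_trans.
  have [||W UW [W1 W2]] := glue _ _ _ _ _ _ (ltn0Sn _) (ltn0Sn _) m0 m'0 MR
    (sigL _ x) (sigL _ y); [by exists x|by exists y|].
  exists W => //; split; first by rewrite /square rectfsE.
  apply/eq_sigLP => q /set_mem /BR2 R2q.
  by have /eq_sigLP := W2; apply; apply/mem_set.
case: BK => BK.
(* All coordinates of [B] lie in [[-k, k]]; a side of [k.+1] starting at [n + K] reaches [k] and is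
   nonempty even if [B] is empty. *)
- exists ((n + K)%:Z, - k%:Z), k.+1, k.*2.+1; split=> //.
    by move=> q Bq; move: (BK _ Bq) (Bk _ Bq); rewrite /rect /=; lia.
  by move=> a b; rewrite /= mem_square /rect /=; lia.
- exists (- k%:Z, (n + K)%:Z), k.*2.+1, k.+1; split=> //.
    by move=> q Bq; move: (BK _ Bq) (Bk _ Bq); rewrite /rect /=; lia.
  by move=> a b; rewrite /= mem_square /rect /=; lia.
Qed.

(** The points [s v] with [s >= n + K] lie beyond the square in a positive coordinate of [v], hence
    are independent of it. The points dropped contribute at most [ln N] each. *)
Lemma lnpatterns_square_segment_ge (R : realType) (N : nat)
    (U : set (config N)) (v : Z2) :
  U !=set0 -> block_gluing R U -> v != 0 -> 1 <= v.1 \/ 1 <= v.2 ->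
  exists K : nat, forall n l : nat,
    lnpatterns R U [set` square n] + lnpatterns R U [set` segfs v l] <=
    lnpatterns R U [set` (square n `|` segfs v l)%fset] +
    (n + K)%:R * ln N%:R.
Proof.
move=> U0 /block_gluing_square[K glue] v0 v1; exists K => n l.
(* The subtraction is truncated: for [l <= n + K] the tail is empty. *)
pose tail := [fset q in [seq v *+ s | s <- iota (n + K) (l - (n + K))]]%fset.
have tailP q : q \in tail -> exists2 s, (n + K <= s < l)%N & q = v *+ s.
  by rewrite inE => /mapP[s]; rewrite mem_iota => sn ->; exists s; [lia|].
have tail_seg : [set` tail] `<=` [set` segfs v l].
  by move=> q /tailP[s sl ->]; apply/mem_segfs; exists s => //; lia.
have seg_sub : [set` segfs v l] `<=` [set` tail] `|` [set` segfs v (n + K)].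
  move=> _ /mem_segfs[s sl <-]; have [sn|sn] := ltnP s (n + K).
    by right; apply/mem_segfs; exists s.
  by left; rewrite /= inE; apply/mapP; exists s; rewrite // mem_iota; lia.
have far : (forall q, q \in tail -> (n + K)%:Z <= q.1) \/
    (forall q, q \in tail -> (n + K)%:Z <= q.2).
  case: v1 => v1; [left|right] => _ /tailP[s sl ->]; rewrite pair_mulrn /=; nia.
have := lnpatternsU_ge R U0 (finite_fset _) (finite_fset _) (glue n tail far).
have finU (A B : {fset Z2}) : finite_set ([set` A] `|` [set` B]).
  by rewrite finite_setU.
have segle := le_trans (le_lnpatterns R U0 (finU _ _) seg_sub)
  (lnpatternsU_le R U0 (finite_fset _) (finite_fset _)).
have sub : [set` square n] `|` [set` tail] `<=`
    [set` (square n `|` segfs v l)%fset].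
  move=> q; rewrite /= in_fsetU => -[->//|/tail_seg /= ->].
  by rewrite orbT.
have := le_lnpatterns R U0 (finite_fset _) sub.
have := lnpatterns_le_card R (segfs v (n + K)) U0; rewrite card_segfs //.
lra.
Qed.

Lemma lnpatterns_square_segment_le (R : realType) (N : nat)
    (U : set (config N)) (v : Z2) (n l : nat) : U !=set0 ->
  lnpatterns R U [set` (square n `|` segfs v l)%fset] <=
  lnpatterns R U [set` square n] + lnpatterns R U [set` segfs v l].
Proof.
by move=> U0; rewrite set_fsetU; exact: lnpatternsU_le.
Qed.

(** A point [s v] of the square has [s <= n], since some coordinate of [v] is at least 1; so the
    overlap has at most [n + 1] points. *)
Lemma card_square_segment (v : Z2) (n l : nat) :
  v != 0 -> 1 <= v.1 \/ 1 <= v.2 ->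
  (#|` (square n `|` segfs v l)%fset| <= n.*2.+1 ^ 2 + l
    <= #|` (square n `|` segfs v l)%fset| + n.+1)%N.
Proof.
move=> v0 v1.
have := cardfsUI (square n) (segfs v l).
rewrite card_rectfs card_segfs // -(card_segfs n.+1 v0) => <-.
rewrite leq_addr leq_add2l fsubset_leq_card //.
apply/fsubsetP => q; rewrite in_fsetI mem_square => /andP[qn].
move=> /mem_segfs[s _ sq]; apply/mem_segfs; exists s => //.
by move: qn; rewrite -sq pair_mulrn /=; case: v1 => v1; nia.
Qed.

(** * Entropy of a square with a segment *)

Lemma expanding_square_segment (v : Z2) (l : nat -> nat) :
  {homo l : i j / (i <= j)%N >-> (i <= j)%N} ->
  expanding_system (fun n => square n `|` segfs v (l n))%fset.
Proof.
move=> lmono; split=> [n|n|].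
- apply/fset0Pn; exists 0; rewrite in_fsetU mem_square /=; lia.
- apply: fsetUSS; apply/fsubsetP => q; first by rewrite !mem_square; lia.
  move=> /mem_segfs[s sl <-]; apply/mem_segfs; exists s => //.
  by apply: leq_trans sl _; exact: lmono.
- apply/seteqP; split=> // q _; exists (`|q.1| + `|q.2|)%N => //=.
  by rewrite in_fsetU mem_square; lia.
Qed.

(** The last hypothesis says, with denominators cleared, that the mean of [hr] and [hl] with weights
    the area of the square and [l n] tends to [h]. *)
Lemma entropy_square_segment (R : realType) (N : nat) (U : set (config N))
    (v : Z2) (hr hl h : R) (l : nat -> nat) :
  U !=set0 -> shift_invariant U -> block_gluing R U ->
  v != 0 -> 1 <= v.1 \/ 1 <= v.2 ->
  rect_entropy R U = hr%:E -> line_entropy R v U = hl%:E ->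
  (forall e, 0 < e -> \forall n \near \oo,
    `|hr * (n.*2.+1 ^ 2)%:R + hl * (l n)%:R - h * (n.*2.+1 ^ 2 + l n)%:R|
      <= e * (n.*2.+1 ^ 2 + l n)%:R) ->
  entropy R (fun n => square n `|` segfs v (l n))%fset U = h%:E.
Proof.
move=> U0 Ui bg v0 v1 hrE hlE mix.
have [hl' [hlE' segge segle]] := line_entropy_fekete R v U0 Ui.
have {hlE'} [hlhl] : hl%:E = hl'%:E by rewrite -hlE.
have [hr' [hrE' sqge sqle]] := rect_entropy_fekete R U0 Ui.
have {hrE'} [hrhr] : hr%:E = hr'%:E by rewrite -hrE.
rewrite -{}hlhl in segge segle; rewrite -{}hrhr in sqge sqle.
have [K glue] := lnpatterns_square_segment_ge U0 bg v0 v1.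
apply: limf_esup_near => e e0.
(* With w = A + l n and W = #|` Omega n|, the total error is at most
   2 d w + Q (n + 1), where w <= 2 W and Q (n + 1) <= d W; whence the 5. *)
have d0 : 0 < e / 5%:R by rewrite divr_gt0.
set d := e / 5%:R in d0.
have [T sqT] := sqle d d0; have [C segC] := segle d d0.
have dmix := mix d d0.
(* The errors linear in [n]: the overlap counted with weight [h], the constant [C] of the segment
   bound, and the dropped ray points, for which [n + K <= (K + 1) (n + 1)]. *)
pose Q := `|h| + `|C| + `|ln N%:R| * K.+1%:R.
near=> n.
have nT : (T <= n.*2.+1)%N.
  by rewrite (leq_trans (n := n)) //; [near: n; exact: nbhs_infty_ge|lia].
have nQ : Q / d <= n%:R by near: n; exact: nbhs_infty_ger.
have nmix : `|hr * (n.*2.+1 ^ 2)%:R + hl * (l n)%:R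
      - h * (n.*2.+1 ^ 2 + l n)%:R| <= d * (n.*2.+1 ^ 2 + l n)%:R.
  by near: n.
set W := (#|` _ |); rewrite -[ln _]/(lnpatterns R U _).
have := card_square_segment n (l n) v0 v1; rewrite -/W => /andP[WA AW].
have AleW : (n.*2.+1 ^ 2 <= W)%N.
  rewrite -mulnn -(card_rectfs (- n%:Z, - n%:Z)).
  by rewrite fsubset_leq_card // fsubsetUl.
have lleW : (l n <= W)%N.
  by rewrite -[l n](card_segfs _ v0) fsubset_leq_card // fsubsetUr.
have W0 : 0 < W%:R :> R by rewrite ltr0n; lia.
set g := lnpatterns R U _.
have -> : W%:R^-1 * g - h = (g - h * W%:R) / W%:R.
  by rewrite mulrBl mulfK ?gt_eqF // [in RHS]mulrC.
rewrite normrM [X in _ * X]ger0_norm ?invr_ge0 // ler_pdivrMr //.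
have := glue n (l n); have := lnpatterns_square_segment_le R v n (l n) U0.
rewrite -/g rectfsE.
have := sqge (- n%:Z, - n%:Z) n.*2.+1 n.*2.+1.
have := sqT (- n%:Z, - n%:Z) _ _ nT nT.
have := segge (l n); have := segC (l n).
set u := lnpatterns R U [set` segfs _ _]; set G := lnpatterns R U (rect _ _ _).
rewrite -mulnn in nmix AleW WA AW *.
set A := (n.*2.+1 * n.*2.+1)%N in nmix AleW WA AW *.
set w := (A + l n)%N in WA AW nmix *.
move=> u1 u2 G1 G2 g1 g2.
clearbody W g u G.
have n2 : (n.+1 <= n.*2.+1)%N by rewrite ltnS -addnn leq_addr.
have nA : (n.+1 * n.+1 <= A)%N := leq_mul n2 n2.
have wE : w%:R = A%:R + (l n)%:R :> R by rewrite natrD.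
(* Both the square and the segment lie in [Omega n]. *)
have w2 : (w <= 2 * W)%N by rewrite mul2n -addnn leq_add.
clearbody A w.
have w2W : w%:R <= 2%:R * W%:R :> R by rewrite -natrM ler_nat.
have wW : W%:R <= w%:R :> R by rewrite ler_nat.
have Ww : w%:R - W%:R <= n.+1%:R :> R by rewrite lerBlDl -natrD ler_nat.
(* Here [Q <= d n] and [(n + 1)^2 <= A <= W]: the area dominates the linear errors. *)
have small : Q * n.+1%:R <= d * W%:R.
  apply: le_trans (_ : d * (n.+1 * n.+1)%:R <= _).
    rewrite natrM mulrA ler_wpM2r // -natr1.
    by move: nQ; rewrite ler_pdivrMr //; nra.
  by rewrite ler_wpM2l ?(ltW d0) // ler_nat (leq_trans nA).
have hw : `|h * (w%:R - W%:R)| <= `|h| * n.+1%:R.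
  by rewrite normrM ler_wpM2l // ger0_norm // subr_ge0.
have lnK : (n + K)%:R * ln N%:R <= `|ln N%:R| * K.+1%:R * n.+1%:R :> R.
  rewrite -mulrA -natrM mulrC.
  apply: le_trans (ler_wpM2r _ (ler_norm _)) (ler_wpM2l _ _) => //.
  by rewrite ler_nat; clear; nia.
have Cn : C <= `|C| * n.+1%:R.
  by rewrite (le_trans (ler_norm C)) // ler_peMr // ler1n.
have hn0 : 0 <= `|h| * n.+1%:R by rewrite mulr_ge0.
have Cn0 : 0 <= `|C| * n.+1%:R by rewrite mulr_ge0.
have ln0 : 0 <= `|ln N%:R| * K.+1%:R * n.+1%:R :> R by rewrite !mulr_ge0.
have dw : d * w%:R <= 2%:R * (d * W%:R) by rewrite mulrCA ler_wpM2l // ltW.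
have eW : e * W%:R = 5%:R * (d * W%:R) by rewrite /d; field.
rewrite eW ler_norml.
move: nmix hw; rewrite !ler_norml => /andP[m1 m2] /andP[h1 h2].
move: small dw m1 m2 h1 h2; rewrite /Q wE.
move: u1 u2 G1 G2 g1 g2 lnK Cn hn0 Cn0 ln0; clear; lra.
Unshelve. all: by end_near. Qed.

(** * Choice of the ray, and the empty shift space *)

(** The gluing estimate needs a ray leaving the square to the right or upwards; one of [v] and [- v]
    gives such a ray, and both give the same entropy. *)
Lemma positive_generator (R : realType) (N : nat) (U : set (config N))
    (L : set Z2) : shift_invariant U -> sublattice1 L ->
  exists v : Z2, [/\ v != 0, 1 <= v.1 \/ 1 <= v.2 &
    proj_entropy R L U = line_entropy R v U].
Proof.
move=> Ui [v v0 ->]; have vN0 : - v != 0 by rewrite oppr_eq0.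
have [v1|v1] : (1 <= v.1 \/ 1 <= v.2) \/ (1 <= (- v).1 \/ 1 <= (- v).2).
  case: v v0 {vN0} => a b ab0 /=.
  suff : a != 0 \/ b != 0 by lia.
  by case: (eqVneq a 0) ab0 => [->|]; [case: (eqVneq b 0) => [->|]; right|left].
- by exists v; split => //; exact: proj_entropyE.
- by exists (- v); split => //; rewrite line_entropyN //; exact: proj_entropyE.
Qed.

(** With the convention [ln 0 = 0], this and the next lemma show that the empty set violates the
    strict inequality of the theorem. *)
Lemma rect_entropy0 (R : realType) (N : nat) :
  rect_entropy R (@set0 (config N)) = 0%:E.
Proof.
apply: limf_esup_near => e e0; apply: nearW => mn.
rewrite /npatterns /patterns image_set0 fset_set0 cardfs0.
by rewrite ln0 // mulr0 subr0 normr0 ltW.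
Qed.

Lemma sup_proj_entropy0 (R : realType) (N : nat) :
  (sup_proj_entropy R (@set0 (config N)) <= 0)%E.
Proof.
apply: ge_ereal_sup => _ [L _ <-]; rewrite /proj_entropy /line_entropy.
under eq_fun do
  rewrite /npatterns /patterns image_set0 fset_set0 cardfs0 ln0 // mulr0.
by rewrite lim_cst.
Qed.

(** * Segment lengths that realise a given mean *)

Lemma segment_lengths_below (R : realType) (hr hl h : R) : hr <= h -> h < hl ->
  exists2 l : nat -> nat, {homo l : i j / (i <= j)%N >-> (i <= j)%N} &
    forall e, 0 < e -> \forall n \near \oo,
      `|hr * (n.*2.+1 ^ 2)%:R + hl * (l n)%:R - h * (n.*2.+1 ^ 2 + l n)%:R|
        <= e * (n.*2.+1 ^ 2 + l n)%:R.
Proof.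
move=> hrh hhl; have hl0 : 0 < hl - h by rewrite subr_gt0.
(* The solution of [(hr + c hl) / (1 + c) = h]. *)
pose c := (h - hr) / (hl - h).
have c0 : 0 <= c by rewrite divr_ge0 // ?subr_ge0 // ltW.
exists (fun n => Num.truncn (c * (n.*2.+1 ^ 2)%:R)).
  move=> i j ij; apply: le_truncn; rewrite ler_wpM2l // ler_nat leq_exp2r //.
  by rewrite ltnS leq_double.
move=> e e0; near=> n; set A := (n.*2.+1 ^ 2)%N; set l := Num.truncn _.
have /andP[lle lge] : l%:R <= c * A%:R < l.+1%:R by apply: truncn_itv; rewrite mulr_ge0.
have big : hl - h <= e * A%:R.
  have : (hl - h) / e <= n%:R by near: n; exact: nbhs_infty_ger.
  rewrite ler_pdivrMr // mulrC => /le_trans; apply.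
  by rewrite ler_wpM2l ?(ltW e0) // ler_nat /A; nia.
(* By the choice of [c] only the rounding of [c A] remains, an error of at most [hl - h]. *)
have -> : hr * A%:R + hl * l%:R - h * (A + l)%:R = (hl - h) * (l%:R - c * A%:R).
  by rewrite /c natrD; field; rewrite gt_eqF.
rewrite normrM gtr0_norm // natrD ler0_norm ?subr_le0 //.
have -> : e * (A%:R + l%:R) = e * A%:R + e * l%:R by rewrite mulrDr.
have el0 : 0 <= e * l%:R by rewrite mulr_ge0 // ltW.
have : (hl - h) * - (l%:R - c * A%:R) <= (hl - h) * 1.
  by rewrite ler_wpM2l ?(ltW hl0) //; move: lge; rewrite -natr1; lra.
lra.
Unshelve. all: by end_near. Qed.

(** No finite ratio [c] gives [hl] when [hr] differs from it, so the ratio [n] tends to infinity;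
    the square then has a share [1 / (n + 1)] of the total weight. *)
Lemma segment_lengths_at (R : realType) (hr hl : R) :
  exists2 l : nat -> nat, {homo l : i j / (i <= j)%N >-> (i <= j)%N} &
    forall e, 0 < e -> \forall n \near \oo,
      `|hr * (n.*2.+1 ^ 2)%:R + hl * (l n)%:R - hl * (n.*2.+1 ^ 2 + l n)%:R|
        <= e * (n.*2.+1 ^ 2 + l n)%:R.
Proof.
exists (fun n => n * n.*2.+1 ^ 2)%N.
  by move=> i j ij; rewrite leq_mul // leq_exp2r // ltnS leq_double.
move=> e e0; near=> n; set A := (n.*2.+1 ^ 2)%N.
have big : `|hr - hl| <= e * n%:R.
  have : `|hr - hl| / e <= n%:R by near: n; exact: nbhs_infty_ger.
  by rewrite ler_pdivrMr // mulrC.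
have -> : hr * A%:R + hl * (n * A)%:R - hl * (A + n * A)%:R = (hr - hl) * A%:R.
  by rewrite natrD; ring.
rewrite normrM [X in _ * X]ger0_norm // natrD natrM.
have := ler_wpM2r (ler0n R A) big.
have : 0 <= e * A%:R by rewrite mulr_ge0 // ltW.
lra.
Unshelve. all: by end_near. Qed.

Unset Implicit Arguments.
Local Open Scope ereal_scope.

Theorem theorem1p4 (R : realType) (N : nat) (hN : (2 <= N)%N)
    (U : set (config N)) (hU : shift_space U) (hbg : block_gluing R U)
    (hlt : rect_entropy R U < sup_proj_entropy R U) :
  (forall h : R,
     rect_entropy R U <= h%:E -> h%:E < sup_proj_entropy R U ->
     exists2 Omega : nat -> {fset Z2},
       expanding_system Omega & entropy R Omega U = h%:E) /\
  (forall L : set Z2,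
     sublattice1 L -> proj_entropy R L U = sup_proj_entropy R U ->
     exists2 Omega : nat -> {fset Z2},
       expanding_system Omega &
       entropy R Omega U = sup_proj_entropy R U /\
       sup_proj_entropy R U = proj_entropy R L U).
Proof.
have [_ Ui] := hU.
have U0 : U !=set0.
  apply/set0P; apply/eqP => U0; move: hlt; rewrite U0 rect_entropy0 ltNge.
  by rewrite sup_proj_entropy0.
have [hr [hrE _ _]] := rect_entropy_fekete R U0 Ui.
split=> [h|L sL LE].
  (* As [h] is strictly below the supremum, some sublattice has entropy above [h]. *)
  rewrite hrE lee_fin => hrh /ereal_sup_gt[_ [L sL <-]].
  have [v [v0 v1 ->]] := positive_generator R Ui sL.
  have [hl [hlE _ _]] := line_entropy_fekete R v U0 Ui.
  rewrite hlE lte_fin => hhl.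
  have [l lmono lmix] := segment_lengths_below hrh hhl.
  exists (fun n => square n `|` segfs v (l n))%fset.
    exact: expanding_square_segment.
  exact: entropy_square_segment hrE hlE lmix.
(* In the attained case the ray lies in the maximising sublattice itself. *)
have [v [v0 v1 Lv]] := positive_generator R Ui sL.
have [hl [hlE _ _]] := line_entropy_fekete R v U0 Ui.
have [l lmono lmix] := segment_lengths_at hr hl.
exists (fun n => square n `|` segfs v (l n))%fset.
  exact: expanding_square_segment.
split=> //; rewrite -LE Lv hlE.
exact: entropy_square_segment hrE hlE lmix.
Qed.
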